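(* Let $t=q_1^{f_1}q_2^{f_2}\cdots q_r^{f_r}$ with $r\ge 2$, $q_1,\dots,q_r$ distinct odd primes and $f_i\ge 1$, and let $p$ be a prime different from all the $q_i$. Let $T_t$ be the $t$-th Chebyshev polynomial. For $1\le i\le r$ let $\delta_i=\operatorname{ord}_{q_i}(p)$ and $\mu_i=v_{q_i}(p^{\delta_i}-1)$, and let $\Delta=\operatorname{lcm}\{\delta_i\}_{1\le i\le r}$. Fix a positive integer $\delta$ and a tuple $\nu=\langle\nu_1,\dots,\nu_r\rangle$ of non-negative integers such that infinitely many positive integers $n$ satisfy $\gcd(\Delta,n)=\delta$ and $v_{q_i}(n)=\nu_i$ for all $i$. Then there are disjoint subsets $I,J\subseteq\{1,2,\dots,r\}$ such that $$\lim_{\substack{n \to \infty\\ \gcd(\Delta,n)=\delta\\ v_{q_i}(n)=\nu_i\ (1\le i\le r)}}\frac{\#\operatorname{Per}\left(T_t, \mathbb{F}_{p^n}\right)}{p^n}=\frac{Q_I+Q_J}{2Q_IQ_J},$$ where $$Q_I=\prod_{i\in I}q_i^{\mu_i+\nu_i}\quad\text{and}\quad Q_J=\prod_{j\in J}q_j^{\mu_j+\nu_j}.$$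
   Context: For a polynomial $\phi$ with integer coefficients (reduced mod $p$) and a field $K$ of characteristic $p$, $\operatorname{Per}(\phi,K)=\{\alpha\in K : \phi^m(\alpha)=\alpha \text{ for some } m>0\}$, where $\phi^m$ is the $m$-th iterate of $\phi$ under composition. $\mathbb{F}_{p^n}$ is the field with $p^n$ elements. $v_q$ denotes $q$-adic valuation, and $\operatorname{ord}_q(p)$ is the smallest positive integer $k$ with $q\mid p^k-1$. The Chebyshev polynomials $T_d\in\mathbb{Z}[w]$ are defined by $T_0(w)=2$, $T_1(w)=w$, $T_d(w)=wT_{d-1}(w)-T_{d-2}(w)$ for $d\ge 2$; equivalently $T_d(z+z^{-1})=z^d+z^{-d}$. An empty product equals $1$. The limit is taken as $n\to\infty$ through the positive integers $n$ satisfying the conditions displayed under the limit sign. *)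

(* Defs.v *)
From mathcomp Require Import all_boot all_order all_algebra.
From mathcomp Require Import all_classical all_reals all_analysis.

Set Implicit Arguments.
Unset Strict Implicit.
Unset Printing Implicit Defensive.

Import Order.TTheory GRing.Theory Num.Theory numFieldNormedType.Exports.

Local Open Scope classical_set_scope.
Local Open Scope ring_scope.

Fixpoint chebyshev_poly (d : nat) : {poly int} :=
  match d with
  | 0 => 2%:R%:P
  | 1 => 'X
  | (d''.+1 as d').+1 => 'X * chebyshev_poly d' - chebyshev_poly d''
  end.

(* [map_poly intr] reduces the integer coefficients of [phi] into [K]. *)
Definition Per (phi : {poly int}) (K : fieldType) : set K :=
  [set a | exists m : nat, (0 < m)%N /\
     iter m (horner (map_poly intr phi : {poly K})) a = a].
Arguments Per : clear implicits.

(* The smallest k > 0 with q | p ^ k - 1; the value 0 is a default, taken only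
   when no such k exists, i.e. never for p > 0 coprime to q. *)
Definition mult_ord (q p : nat) : nat :=
  if pselect (exists k, (0 < k)%N && (q %| p ^ k - 1)%N) is left ex_k
  then ex_minn ex_k else 0%N.

Definition mu (q p : nat) : nat := logn q (p ^ mult_ord q p - 1).

Definition Delta (r : nat) (q : 'I_r -> nat) (p : nat) : nat :=
  \big[lcmn/1%N]_(i < r) mult_ord (q i) p.

Definition exponents (r : nat) (q : 'I_r -> nat) (p delta : nat)
    (nu : 'I_r -> nat) : set nat :=
  [set n | [/\ (0 < n)%N, gcdn (Delta q p) n = delta
             & forall i, logn (q i) n = nu i]].

Definition Qprod (r : nat) (q : 'I_r -> nat) (p : nat) (nu : 'I_r -> nat)
    (I : {set 'I_r}) : nat :=
  (\prod_(i in I) q i ^ (mu (q i) p + nu i))%N.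

(* Main.v *)
(** Write [N = p ^ n] and let [K] be an algebraic closure of [F_N].  Every
    element of [K] is [z + z^-1] for some [z != 0], it lies in [F_N] iff
    [z ^+ (N - 1) = 1] or [z ^+ (N + 1) = 1], and [T_t] acts by
    [z |-> z ^+ t], so [z + z^-1] is periodic iff the order of [z] is coprime
    to [t].  Let [A] and [B] be the largest divisors of [N - 1] and [N + 1]
    coprime to [t].  Counting the [A]-th together with the [B]-th roots of
    unity hits every periodic point exactly twice ([z = z^-1] being a root of
    both kinds), so there are [(A + B) / 2] periodic points.  By lifting the
    exponent, [(N - 1) / A] and [(N + 1) / B] are [Q_I] and [Q_J], where [I] is
    the set of [i] with [delta_i | n] and [J] the set of [i] with
    [delta_i | 2 n] but not [delta_i | n]; both depend only on
    [gcd (Delta, n)]. *)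
Require Import Defs.
From mathcomp Require Import all_boot all_order all_algebra.
From mathcomp Require Import finfield closed_field separable cyclotomic.
From mathcomp Require Import abelian cyclic.
From mathcomp Require Import all_classical all_reals all_analysis.
From mathcomp Require Import ring zify.

Set Implicit Arguments.
Unset Strict Implicit.
Unset Printing Implicit Defensive.

Import Order.TTheory GRing.Theory Num.Theory numFieldNormedType.Exports.

Local Open Scope classical_set_scope.
Local Open Scope ring_scope.

(** * Valuations of [p ^ n - 1] and [p ^ n + 1] at an odd prime *)

Lemma dvdn_subn1_exp (m a b : nat) : (a %| b)%N -> (m ^ a - 1 %| m ^ b - 1)%N.
Proof.
move=> /dvdnP[c ->]; rewrite mulnC expnM !subn1.
by rewrite [(_ ^ c).-1]predn_exp dvdn_mulr.
Qed.

(** Euler's theorem makes the minimum exist, so the default value of [mult_ord] is not taken;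
    division with remainder and minimality do the rest. *)
Lemma mult_ordP (q p : nat) : prime q -> coprime q p ->
  (0 < mult_ord q p)%N /\ forall n, (q %| p ^ n - 1)%N = (mult_ord q p %| n)%N.
Proof.
move=> q_pr qp.
have p0 : (0 < p)%N.
  rewrite lt0n; apply: contraTneq qp => ->.
  by rewrite /coprime gcdn0 neq_ltn prime_gt1 ?orbT.
have ex : exists k, (0 < k)%N && (q %| p ^ k - 1)%N.
  exists (totient q); rewrite totient_gt0 prime_gt0//=.
  by rewrite -eqn_mod_dvd ?expn_gt0 ?p0// Euler_exp_totient// coprime_sym.
rewrite /mult_ord; case: pselect => // {}ex.
case: ex_minnP => d /andP[d0 qd] d_min; split=> // n.
apply/idP/idP => [qn|dn]; last exact: dvdn_trans qd (dvdn_subn1_exp p dn).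
rewrite /dvdn; apply: contraTT (ltn_pmod n d0) => r0; rewrite -leqNgt.
apply: d_min; rewrite lt0n r0 /= -eqn_mod_dvd ?expn_gt0 ?p0//.
move: qn; rewrite {1}(divn_eq n d) -eqn_mod_dvd ?expn_gt0 ?p0// expnD -modnMml.
suff /eqP -> : p ^ (n %/ d * d) == 1 %[mod q] by rewrite modnMml mul1n.
rewrite eqn_mod_dvd ?expn_gt0 ?p0//.
by apply: dvdn_trans qd _; rewrite dvdn_subn1_exp// dvdn_mull.
Qed.

(** The cofactor [\sum_(i < n) x ^ i] of [x - 1] is congruent to [n] mod [q], hence prime to [q]. *)
Lemma logn_subn1_exp_coprime (q x n : nat) : prime q -> (1 < x)%N ->
  (q %| x - 1)%N -> (0 < n)%N -> coprime q n ->
  logn q (x ^ n - 1) = logn q (x - 1).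
Proof.
move=> q_pr x1 qx n0 qn; rewrite !subn1 predn_exp mulnC logn_Gauss//.
rewrite -coprime_modr -modn_summ.
rewrite (eq_bigr (fun=> 1 %% q)%N).
  by rewrite modn_summ coprime_modr sum_nat_const card_ord muln1.
move=> i _; apply/eqP; rewrite eqn_mod_dvd ?expn_gt0 ?(ltnW x1)//.
by apply: dvdn_trans qx _; rewrite -{1}[x]expn1 dvdn_subn1_exp ?dvd1n.
Qed.

Lemma logn_subn1_exp_prime (q x : nat) : prime q -> odd q -> (1 < x)%N ->
  (q %| x - 1)%N -> logn q (x ^ q - 1) = (logn q (x - 1)).+1.
Proof.
move=> q_pr q_odd x1 qx; rewrite !subn1 predn_exp.
have q0 := prime_gt0 q_pr; have x0 := ltnW x1.
have S0 : (0 < \sum_(i < q) x ^ i)%N.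
  by case: q q0 {q_pr q_odd qx} => // q _; rewrite big_ord_recl expn0.
rewrite lognM// -?subn1 ?subn_gt0// -[RHS]addn1; congr addn.
have [y xy] : exists y, x = (1 + q * y)%N.
  by have /dvdnP[y] := qx; exists y; lia.
(* [x ^ i] is [1 + i q y] mod [q ^ 2]; summing over [i < q] leaves just [q], as
   [q] is odd. *)
have xi i : x ^ i = 1 + q * (i * y) %[mod q ^ 2].
  elim: i => [|i IH]; first by rewrite mul0n muln0 addn0 expn0.
  rewrite expnSr -modnMml IH modnMml xy.
  have -> : ((1 + q * (i * y)) * (1 + q * y)
     = (i * y * y) * q ^ 2 + (1 + q * (i.+1 * y)))%N by nia.
  by rewrite modnMDl.
have Sq : \sum_(i < q) x ^ i = q %[mod q ^ 2].
  rewrite -modn_summ (eq_bigr (fun i : 'I_q => (1 + q * (i * y)) %% q ^ 2)%N);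
    last by move=> i _; exact: xi.
  rewrite modn_summ big_split /= sum_nat_const card_ord muln1.
  rewrite -big_distrr -big_distrl /= -(big_mkord xpredT id) bin2_sum.
  have -> : 'C(q, 2) = (q * q.-1./2)%N by rewrite bin2odd.
  by rewrite mulnA mulnA mulnn -mulnA [(q ^ 2 * _)%N]mulnC addnC modnMDl.
have q2 : (q < q ^ 2)%N by rewrite -{1}[q]expn1 ltn_exp2l ?prime_gt1.
apply/eqP; rewrite eqn_leq -ltnS ltnNge -!pfactor_dvdn//; apply/andP; split.
  by rewrite /dvdn Sq modn_small// -lt0n.
rewrite expn1 /dvdn -(modn_dvdm _ (dvdn_exp (m:=q) (k:=2) isT (dvdnn q))) Sq.
by rewrite modn_dvdm ?modnn// dvdn_exp.
Qed.

(** Lifting the exponent: write [n] as [k * q ^ e] with [k] prime to [q]. Passing to [x ^ k] keeps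
    the valuation, and each of the [e] further powers by [q] adds one. *)
Lemma logn_subn1_exp (q x n : nat) : prime q -> odd q -> (1 < x)%N ->
  (q %| x - 1)%N -> (0 < n)%N ->
  logn q (x ^ n - 1) = (logn q (x - 1) + logn q n)%N.
Proof.
move=> q_pr q_odd x1 qx n0.
have [k kq nE] := pfactor_coprime q_pr n0.
have k0 : (0 < k)%N by move: n0; rewrite nE muln_gt0 => /andP[].
rewrite [in LHS]nE; move: (logn q n) nE => e _.
have xk1 : (1 < x ^ k)%N by rewrite -[1%N](exp1n k) ltn_exp2r.
have -> : logn q (x - 1) = logn q (x ^ k - 1) by rewrite logn_subn1_exp_coprime.
have qxk : (q %| x ^ k - 1)%N.
  by apply: dvdn_trans qx _; rewrite -{1}[x]expn1 dvdn_subn1_exp ?dvd1n.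
rewrite expnM; move: (x ^ k)%N xk1 qxk => {qx x1} {}x.
elim: e x => [|e IH] x x1 qx; first by rewrite expn0 expn1 addn0.
rewrite expnS expnM IH.
- by rewrite logn_subn1_exp_prime// addSnnS.
- by rewrite -[1%N](exp1n q) ltn_exp2r// prime_gt0.
- by apply: dvdn_trans qx _; rewrite -{1}[x]expn1 dvdn_subn1_exp ?dvd1n.
Qed.

(** Lifting the exponent is applied to the base [p ^ mult_ord q p]. The order divides [q.-1], hence
    is prime to [q], so dividing [n] by it keeps [logn q n]. *)
Lemma logn_subn1_expn (q p n : nat) : prime q -> odd q -> (1 < p)%N ->
  coprime q p -> (0 < n)%N ->
  logn q (p ^ n - 1) =
    if (mult_ord q p %| n)%N then (mu q p + logn q n)%N else 0%N.
Proof.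
move=> q_pr q_odd p1 qp n0; have [d0 dP] := mult_ordP q_pr qp.
case: ifPn => [/dvdnP[c nE]|dn]; last first.
  rewrite -dP in dn; apply: logn_coprime; rewrite prime_coprime//.
have c0 : (0 < c)%N by move: n0; rewrite nE muln_gt0 => /andP[].
have d_tot : (mult_ord q p %| q.-1)%N.
  rewrite -dP -totient_prime// -eqn_mod_dvd ?expn_gt0 ?(ltnW p1)//.
  by rewrite Euler_exp_totient// coprime_sym.
have dq : logn q (mult_ord q p) = 0%N.
  apply: ltn_log0; rewrite -[X in (_ < X)%N](prednK (prime_gt0 q_pr)) ltnS.
  by rewrite dvdn_leq// -ltnS prednK ?prime_gt1 ?prime_gt0.
rewrite [in LHS]nE mulnC expnM logn_subn1_exp// ?dP//.
  by rewrite nE lognM// dq addn0.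
by rewrite -[1%N](exp1n (mult_ord q p)) ltn_exp2r.
Qed.

(** As [p ^ (n * 2) - 1] is the product of [p ^ n - 1] and [p ^ n + 1], the valuation is a
    difference of two known ones. If the order divides [n], then [p ^ n + 1] is [2] mod the odd
    prime [q]. *)
Lemma logn_addn1_expn (q p n : nat) : prime q -> odd q -> (1 < p)%N ->
  coprime q p -> (0 < n)%N ->
  logn q (p ^ n + 1) =
    if ~~ (mult_ord q p %| n)%N && (mult_ord q p %| n * 2)%N
    then (mu q p + logn q n)%N else 0%N.
Proof.
move=> q_pr q_odd p1 qp n0; have [_ dP] := mult_ordP q_pr qp.
have q2 : (2 < q)%N by case: q q_pr q_odd {qp dP} => [|[|[|]]].
have pn1 : (1 < p ^ n)%N by rewrite -[1%N](exp1n n) ltn_exp2r.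
have [dn|dn] /= := boolP (mult_ord q p %| n)%N.
  apply: logn_coprime; rewrite prime_coprime//; rewrite -dP in dn.
  have -> : (p ^ n + 1 = (p ^ n - 1) + 2)%N by lia.
  by rewrite dvdn_addr//; apply: contraTN q2 => /dvdn_leq; rewrite -leqNgt; apply.
have logn2 : logn q (n * 2) = logn q n by rewrite lognM// (ltn_log0 q2) addn0.
have := logn_subn1_expn q_pr q_odd p1 qp (n := (n * 2)%N).
rewrite muln_gt0 n0 logn2 => /(_ isT) <-.
have -> : (p ^ (n * 2) - 1 = (p ^ n - 1) * (p ^ n + 1))%N.
  by rewrite expnM -(subn_sqr _ 1).
rewrite lognM ?subn_gt0 ?addn1// [X in (X + _)%N]logn_subn1_expn//.
by rewrite (negPf dn).
Qed.

(** * The part of an integer supported on the primes dividing [t] *)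

Lemma logn_prod_primes (I : finType) (q e : I -> nat) (x : nat) :
  (forall i, prime (q i)) ->
  logn x (\prod_i q i ^ e i) = (\sum_(i | x == q i) e i)%N.
Proof.
move=> q_pr; rewrite [RHS]big_mkcond /=.
have prod_gt0 (r : seq I) : (0 < \prod_(i <- r) q i ^ e i)%N.
  by rewrite prodn_gt0// => i; rewrite expn_gt0 prime_gt0.
elim: (index_enum I) => [|i r IH]; first by rewrite !big_nil logn1.
rewrite !big_cons lognM// ?expn_gt0 ?prime_gt0// IH lognX logn_prime//.
by case: eqP => _; rewrite ?muln1 ?muln0.
Qed.

Lemma logn_partn (pi : nat_pred) (x n : nat) : (0 < n)%N ->
  logn x n`_pi = if x \in pi then logn x n else 0%N.
Proof.
move=> n0.
have out (rho : nat_pred) : x \notin rho -> logn x n`_rho = 0%N.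
  move=> xrho; apply/eqP; rewrite -leqn0 leqNgt logn_gt0.
  by have := pi_of_part rho n0 x; rewrite !inE (negPf xrho) andbF => ->.
case: ifPn => [xpi|]; last exact: out.
rewrite -[in RHS](partnC pi n0) lognM ?part_gt0// (out pi^'%N) ?addn0//.
by rewrite !inE negbK.
Qed.

(** Every [f i] is positive, so the primes of the product are exactly the values of [q]; the two
    sides are then compared valuation by valuation. *)
Lemma partn_pi_prod_primes (I : finType) (q f : I -> nat) (N : nat) :
  (forall i, prime (q i)) -> injective q -> (forall i, (1 <= f i)%N) ->
  (0 < N)%N ->
  (N`_\pi(\prod_i q i ^ f i) = \prod_i q i ^ logn (q i) N)%N.
Proof.
move=> q_pr q_inj f1 N0; apply: eqn_from_log => [||x]; first exact: part_gt0.
  by rewrite prodn_gt0// => i; rewrite expn_gt0 prime_gt0.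
rewrite logn_prod_primes// logn_partn//.
rewrite /pi_of /= inE -logn_gt0 logn_prod_primes//.
have [/existsP[i /eqP ->]|nx] := boolP [exists i, x == q i].
  have E (e : I -> nat) : (\sum_(j | q i == q j) e j = e i)%N.
    by rewrite (big_pred1 i)// => j; rewrite /= (inj_eq q_inj) eq_sym.
  by rewrite !E f1.
rewrite !big_pred0 ?ltnn// => i; apply/negbTE.
  by apply: contraNN nx => ?; apply/existsP; exists i.
by apply: contraNN nx => ?; apply/existsP; exists i.
Qed.

(** * Chebyshev polynomials in the coordinate [z + z^-1] *)

Lemma horner_chebyshev_addV (K : fieldType) (d : nat) (z : K) : z != 0 ->
  (map_poly intr (chebyshev_poly d)).[z + z^-1] = z ^+ d + z ^- d.
Proof.
(* The recurrence has order two, so two consecutive degrees are proved together. *)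
move=> z0; suff [] : (map_poly intr (chebyshev_poly d)).[z + z^-1]
    = z ^+ d + z ^- d /\
  (map_poly intr (chebyshev_poly d.+1)).[z + z^-1] = z ^+ d.+1 + z ^- d.+1 by [].
elim: d => [|d [IH0 IH1]]; last split=> //.
  rewrite /= map_polyC map_polyX hornerC hornerX expr0 expr1 invr1.
  split=> //.
have -> : chebyshev_poly d.+2 = 'X * chebyshev_poly d.+1 - chebyshev_poly d by [].
rewrite rmorphB rmorphM /= map_polyX hornerD hornerN hornerM hornerX IH0 IH1.
rewrite !exprS; field; by rewrite expf_neq0.
Qed.

Lemma iter_chebyshev_addV (K : fieldType) (d m : nat) (z : K) : z != 0 ->
  iter m (horner (map_poly intr (chebyshev_poly d))) (z + z^-1)
    = z ^+ (d ^ m) + z ^- (d ^ m).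
Proof.
move=> z0; elim: m => [|m IH]; first by rewrite expr1.
by rewrite iterS IH horner_chebyshev_addV ?expf_neq0// expnSr exprM -exprVn.
Qed.

Lemma addV_eq (K : fieldType) (z w : K) : z != 0 -> w != 0 ->
  (z + z^-1 == w + w^-1) = (z == w) || (z == w^-1).
Proof.
move=> z0 w0; rewrite -subr_eq0.
have -> : z + z^-1 - (w + w^-1) = (z - w) * (z - w^-1) / z by field; rewrite z0 w0.
by rewrite !mulf_eq0 !subr_eq0 invr_eq0 (negPf z0) orbF.
Qed.

(** Such a [z] is a root of [Z^2 - x Z + 1], nonzero because the constant term is. *)
Lemma addV_exists (K : closedFieldType) (x : K) :
  exists2 z : K, z != 0 & x = z + z^-1.
Proof.
have [z /esym/eqP] :=
  @solve_monicpoly K 2 (fun i => if i == 0%N then - 1 else x) isT.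
rewrite !big_ord_recl big_ord0 /= expr0 mulr1 expr1 addr0 => /eqP h.
have z0 : z != 0.
  by apply/eqP => z0; move/eqP: h; rewrite z0 expr0n mulr0 addr0 oppr_eq0 oner_eq0.
exists z => //; apply: (mulIf z0); rewrite mulrDl mulVf// -expr2 -h; ring.
Qed.

(** * Roots of unity, fixed points of Frobenius, and periodicity *)

Lemma unity_roots_seq (K : closedFieldType) (n : nat) : n%:R != 0 :> K ->
  exists s : seq K, [/\ uniq s, size s = n & forall z, (z \in s) = (z ^+ n == 1)].
Proof.
move=> nK; have n0 : (0 < n)%N by case: n nK => //; rewrite eqxx.
have [s] := closed_field_poly_normal ('X^n - 1 : {poly K}).
rewrite (eqP (monicXnsubC 1 n0)) scale1r => Es.
exists s; split.
(* ['X^n - 1] is separable because [n] is nonzero in [K], so its roots are distinct. *)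
- by rewrite -separable_prod_XsubC -Es separable_Xn_sub_1.
- by have := size_XnsubC (1 : K) n0; rewrite Es size_prod_XsubC => -[].
- move=> z; rewrite -root_prod_XsubC -Es rootE !hornerE ?hornerXn.
  by rewrite subr_eq0.
Qed.

(** The polynomial ['X^#|F| - 'X] already has the [#|F|] roots [phi a]; one more would exceed its
    degree. *)
Lemma expf_card_image (F : finFieldType) (K : fieldType)
    (phi : {rmorphism F -> K}) (x : K) : x ^+ #|F| = x -> exists a, x = phi a.
Proof.
move=> xF; apply: contrapT => nx.
have F1 := finNzRing_gt1 F.
have sz : size ('X^#|F| - 'X : {poly K}) = #|F|.+1.
  by rewrite size_polyDl ?size_polyXn// size_polyN size_polyX.
have p0 : 'X^#|F| - 'X != 0 :> {poly K} by rewrite -size_poly_eq0 sz.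
have := @max_poly_roots _ _ (x :: [seq phi a | a <- enum F]) p0.
rewrite sz /= size_map -cardE ltnn => H; suff: false by []; apply: H.
- rewrite rootE !hornerE ?hornerXn xF subrr eqxx /=.
  apply/allP => _ /mapP[a _ ->].
  by rewrite rootE !hornerE ?hornerXn -rmorphXn /= expf_card subrr.
- rewrite map_inj_uniq ?enum_uniq ?andbT; last exact: fmorph_inj.
  by apply/mapP => -[a _ xa]; apply: nx; exists a.
Qed.

(** Used with [n = #|F|] to detect membership in [F], and with [n = t ^ m] to detect periodicity. *)
Lemma expr_addV_eq (K : fieldType) (z : K) (n : nat) : z != 0 -> (0 < n)%N ->
  (z ^+ n + z ^- n == z + z^-1) = (z ^+ n.-1 == 1) || (z ^+ n.+1 == 1).
Proof.
case: n => // n z0 _; rewrite addV_eq ?expf_neq0//=; congr (_ || _).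
  by rewrite exprS -[X in _ == X]mulr1 (inj_eq (mulfI z0)).
by rewrite [in RHS]exprS -(inj_eq (mulfI z0)) mulfV.
Qed.

(* As [T_t] maps [z + z^-1] to [z ^+ t + z ^- t], this says that [z + z^-1] is a
   periodic point of [T_t]. *)
Definition periodic_addV (K : fieldType) (t : nat) (z : K) : Prop :=
  exists m, (0 < m)%N /\ z ^+ (t ^ m) + z ^- (t ^ m) = z + z^-1.

(** By Euler's theorem [t ^ totient n] is [1] mod [n], so [totient n] is a period. *)
Lemma coprime_periodic_addV (K : fieldType) (z : K) (n t : nat) :
  (0 < n)%N -> coprime t n -> z ^+ n = 1 -> periodic_addV t z.
Proof.
move=> n0 cop zn; exists (totient n); split; first by rewrite totient_gt0.
by rewrite -(expr_mod (t ^ _) zn) (Euler_exp_totient cop) (expr_mod 1 zn) expr1.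
Qed.

(** Periodicity makes the order of [z] divide [t ^ m - 1] or [t ^ m + 1], so it is prime to [t]; it
    then divides [n] iff it divides the prime-to-[t] part of [n]. *)
Lemma periodic_addV_expr (K : fieldType) (z : K) (n t : nat) :
  z != 0 -> (0 < n)%N -> (0 < t)%N -> periodic_addV t z ->
  (z ^+ (n`_\pi(t)^')%N == 1) = (z ^+ n == 1).
Proof.
move=> z0 n0 t0 [m [m0 /eqP zm]]; apply/eqP/eqP => [zA|zn].
  by rewrite -(partnC \pi(t) n0) mulnC exprM zA expr1n.
have [ o oz oN] := prim_order_exists n0 zn.
rewrite expr_addV_eq ?expn_gt0 ?t0// in zm.
have o0 : (0 < o)%N := dvdn_gt0 n0 oN.
have cop : coprime t o.
  have tm : (t %| t ^ m)%N by rewrite dvdn_exp.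
  rewrite coprime_sym; apply: coprime_dvdr tm _.
  have tm0 : (0 < t ^ m)%N by rewrite expn_gt0 t0.
  case/orP: zm; rewrite -(prim_order_dvd oz) => /coprime_dvdl; apply.
    by rewrite -{2}(prednK tm0) coprimenS.
  by rewrite coprimeSn.
apply/eqP; rewrite -(prim_order_dvd oz).
rewrite coprime_pi' // in cop.
by rewrite -(part_pnat_id cop) partn_dvd.
Qed.

(** * Counting periodic points over a finite field *)

Lemma finField_card_pnat (F : finFieldType) : [char F].-nat #|F|.
Proof.
have [p _ pF] := finPcharP F.
(* The additive group of [F] is elementary abelian, so its order is a power of [p]. *)
have := abelem_pgroup (fin_ring_pchar_abelem pF).
by rewrite /pgroup.pgroup cardsT (eq_pnat _ (pcharf_eq pF)).
Qed.

(** The fibre of [z + z^-1] through [w] consists of [w] and [w^-1], which lie in [s] together or not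
    at all; these are two points unless [w = w^-1]. *)
Lemma count_addV (K : fieldType) (s : seq K) (w : K) :
  uniq s -> 0 \notin s -> w != 0 -> (w^-1 \in s) = (w \in s) ->
  count (fun z => z + z^-1 == w + w^-1) s = ((w \in s) * (w != w^-1).+1)%N.
Proof.
move=> us s0 w0 ws.
have -> : count (fun z => z + z^-1 == w + w^-1) s
    = count (predU (pred1 w) (pred1 w^-1)) s.
  apply: eq_in_count => z zs /=; rewrite addV_eq//.
  by apply: contraNneq s0 => <-.
have := count_predUI (pred1 w) (pred1 w^-1) s.
rewrite !count_uniq_mem// ws.
have [wV|wV] /= := eqVneq w w^-1.
  have -> : count (predI (pred1 w) (pred1 w^-1)) s = (w \in s).
    by rewrite -(count_uniq_mem _ us); apply: eq_count => z /=; rewrite -wV andbb.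
  by rewrite muln1 => /addIn.
have -> : count (predI (pred1 w) (pred1 w^-1)) s = 0%N.
  rewrite -(count_pred0 s); apply: eq_count => z /=.
  by case: eqP => //= ->; exact/negbTE.
by rewrite addn0 muln2 addnn.
Qed.

Section PeriodicPoints.
Variables (F : finFieldType) (K : closedFieldType) (phi : {rmorphism F -> K}).

(** An element of [K] comes from [F] iff it is fixed by [x |-> x ^+ #|F|], which is additive and so
    sends [z + z^-1] to [z ^+ #|F| + z ^- #|F|]. *)
Lemma finField_image_addV (z : K) : z != 0 ->
  reflect (exists a, phi a = z + z^-1)
          ((z ^+ #|F|.-1 == 1) || (z ^+ #|F|.+1 == 1)).
Proof.
move=> z0; have F0 : (0 < #|F|)%N := ltnW (finNzRing_gt1 F).
have zF : (z + z^-1) ^+ #|F| = z ^+ #|F| + z ^- #|F|.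
  rewrite exprDn_pchar ?exprVn// (eq_pnat _ (fmorph_pchar phi)).
  exact: finField_card_pnat.
rewrite -expr_addV_eq// -zF; apply: (iffP eqP) => [zfix|[a <-]].
  by have [a ->] := expf_card_image phi zfix; exists a.
by rewrite -rmorphXn /= expf_card.
Qed.

Lemma Per_addV (t : nat) (a : F) (z : K) : z != 0 ->
  phi a = z + z^-1 ->
  Per (chebyshev_poly t) F a <-> periodic_addV t z.
Proof.
move=> z0 az.
have E m : phi (iter m (horner (map_poly intr (chebyshev_poly t))) a)
    = z ^+ (t ^ m) + z ^- (t ^ m).
  rewrite -iter_chebyshev_addV// -az; elim: m => //= m <-.
  rewrite -horner_map -map_poly_comp; congr (_.[_]).
  by apply: eq_map_poly => c /=; rewrite rmorph_int.
split=> -[m [m0 /= H]]; exists m; split=> //; first by rewrite -E H.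
by apply: (fmorph_inj phi); rewrite E H az.
Qed.

End PeriodicPoints.

Lemma card_Per_chebyshev (F : finFieldType) (t : nat) : (0 < t)%N ->
  (#|Per (chebyshev_poly t) F| * 2
    = (#|F|.-1)`_\pi(t)^' + (#|F|.+1)`_\pi(t)^')%N.
Proof.
move=> t0.
have [K [phi _]] := countable_algebraic_closure F.
have F1 := finNzRing_gt1 F.
have qK : #|F|%:R = 0 :> K.
  have [p _ pF] := finPcharP F.
  have pK : p \in [char K] by rewrite (fmorph_pchar phi).
  apply/eqP; rewrite -(dvdn_pcharf pK).
  have := finField_card_pnat F; rewrite (eq_pnat _ (pcharf_eq pF)).
  by case/p_natP=> -[|k] qE; [rewrite qE in F1 | rewrite qE dvdn_exp].
(* [#|F|.-1] and [#|F|.+1] are [-1] and [1] in [K], so their divisors are nonzero in [K], as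
   [unity_roots_seq] requires. *)
have nz N B : (N`_\pi(t)^' * B)%N%:R != 0 :> K -> (N`_\pi(t)^')%N%:R != 0 :> K.
  by rewrite natrM mulf_eq0 negb_or => /andP[].
have q1K : (#|F|.-1)%:R = -1 :> K.
  by apply/eqP; rewrite -subr_eq0 opprK natr1 prednK ?qK// ltnW.
have AK : ((#|F|.-1)`_\pi(t)^')%N%:R != 0 :> K.
  apply: (nz _ ((#|F|.-1)`_\pi(t))%N).
  by rewrite mulnC partnC ?q1K ?oppr_eq0 ?oner_neq0// -ltnS prednK// ltnW.
have BK : ((#|F|.+1)`_\pi(t)^')%N%:R != 0 :> K.
  apply: (nz _ ((#|F|.+1)`_\pi(t))%N).
  by rewrite mulnC partnC// -natr1 qK add0r oner_neq0.
have [sA [usA szA sAP]] := unity_roots_seq AK.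
have [sB [usB szB sBP]] := unity_roots_seq BK.
have s0 (n : nat) : n%:R != 0 :> K -> (0 : K) ^+ n != 1.
  by case: n => [|n _]; rewrite ?eqxx// expr0n eq_sym oner_neq0.
have sA0 : 0 \notin sA by rewrite sAP s0.
have sB0 : 0 \notin sB by rewrite sBP s0.
have sAV z : (z^-1 \in sA) = (z \in sA) by rewrite !sAP exprVn invr_eq1.
have sBV z : (z^-1 \in sB) = (z \in sB) by rewrite !sBP exprVn invr_eq1.
have q0 : (0 < #|F|.-1)%N by rewrite -ltnS prednK// ltnW.
have sA_per z : z \in sA -> periodic_addV t z.
  rewrite sAP => /eqP; apply: coprime_periodic_addV; first exact: part_gt0.
  by rewrite coprime_pi' ?part_gt0 ?part_pnat.
have sB_per z : z \in sB -> periodic_addV t z.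
  rewrite sBP => /eqP; apply: coprime_periodic_addV; first exact: part_gt0.
  by rewrite coprime_pi' ?part_gt0 ?part_pnat.
have s_im z : z \in sA ++ sB ->
    exists2 a, a \in Per (chebyshev_poly t) F & phi a = z + z^-1.
  move=> zs; have z0 : z != 0.
    by apply: contraTneq zs => ->; rewrite mem_cat negb_or sA0.
  have zper : periodic_addV t z.
    by move: zs; rewrite mem_cat => /orP[/sA_per|/sB_per].
  have /(finField_image_addV phi z0)[a az] :
      (z ^+ #|F|.-1 == 1) || (z ^+ #|F|.+1 == 1).
    rewrite -(periodic_addV_expr z0 q0 t0 zper).
    by rewrite -[X in _ || X](periodic_addV_expr z0 _ t0 zper)// -sAP -sBP -mem_cat.
  by exists a => //; apply/mem_set/(Per_addV t z0 az).
have s_count a : a \in Per (chebyshev_poly t) F ->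
    count (fun z => z + z^-1 == phi a) (sA ++ sB) = 2%N.
  move=> /set_mem aPer; have [w w0 aw] := addV_exists (phi a).
  have wper := (Per_addV t w0 aw).1 aPer.
  rewrite aw count_cat !count_addV// -mulnDl.
  rewrite sAP sBP (periodic_addV_expr w0 q0 t0 wper).
  rewrite (periodic_addV_expr w0 _ t0 wper)//.
  have : (w ^+ #|F|.-1 == 1) || (w ^+ #|F|.+1 == 1).
    by apply/(finField_image_addV phi w0); exists a.
  (* Expressing everything by [w ^+ #|F|.-1] and [w ^+ 2] leaves a case analysis on which of them is
     [1]. *)
  have -> : (w ^+ #|F|.+1 == 1) = (w ^+ #|F|.-1 * w ^+ 2 == 1).
    by rewrite -exprD addn2 prednK// ltnW.
  have -> : (w == w^-1) = (w ^+ 2 == 1).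
    by rewrite -(inj_eq (mulfI w0)) mulfV.
  (* [w] is a root of both kinds iff [w ^+ 2 = 1], i.e. iff [w = w^-1]. *)
  have [->|w2] := eqVneq (w ^+ 2) 1; first by rewrite mulr1 orbb => ->.
  have [->|//] := eqVneq (w ^+ #|F|.-1) 1; first by rewrite mul1r (negPf w2).
  by move=> w1 /= ->.
(* Double counting of the pairs [a], [z] with [phi a = z + z^-1]: two for each periodic [a], and one
   for each listed [z] as [phi] is injective. *)
rewrite -szA -szB -size_cat -sum1_size -sum_nat_const.
rewrite -(eq_bigr _ s_count).
under eq_bigr do rewrite -sum1_count big_mkcond.
rewrite exchange_big /= [LHS]big_seq [RHS]big_seq.
apply: eq_bigr => z /s_im[a aP az].
rewrite (bigD1 a)//= -az eqxx big1 ?addn0// => b /andP[_ ba].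
by rewrite (inj_eq (fmorph_inj phi)) eq_sym (negPf ba).
Qed.

(** * The limit along the prescribed exponents [n] *)

Lemma exponents_dvdn (r : nat) (q : 'I_r -> nat) (p delta n : nat)
    (nu : 'I_r -> nat) (i : 'I_r) : exponents q p delta nu n ->
  (mult_ord (q i) p %| n)%N = (mult_ord (q i) p %| delta)%N /\
  (mult_ord (q i) p %| n * 2)%N = (mult_ord (q i) p %| delta * 2)%N.
Proof.
move=> [_ <- _].
have dD : (mult_ord (q i) p %| Delta q p)%N.
  by rewrite /Delta (bigD1 i)//= dvdn_lcml.
(* The order divides [Delta], so it divides [n] iff it divides the gcd of [Delta] and [n]; doubling
   commutes with the gcd. *)
by rewrite muln_gcdl !dvdn_gcd dD (dvdn_mulr 2 dD).
Qed.

Theorem theorem5p8 (R : realType) (r : nat) (q f : 'I_r -> nat) (p t : nat)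
    (delta : nat) (nu : 'I_r -> nat)
    (r_ge2 : (2 <= r)%N)
    (q_prime : forall i, prime (q i))
    (q_odd : forall i, odd (q i))
    (q_inj : injective q)
    (f_ge1 : forall i, (1 <= f i)%N)
    (t_def : t = (\prod_(i < r) q i ^ f i)%N)
    (p_prime : prime p)
    (p_neq_q : forall i, p <> q i)
    (delta_gt0 : (0 < delta)%N)
    (inf_exp : infinite_set (exponents q p delta nu)) :
  exists I J : {set 'I_r}, [disjoint I & J]%bool /\
    forall F : nat -> finFieldType,
      (forall n, (0 < n)%N -> #|F n| = (p ^ n)%N) ->
      (#|Per (chebyshev_poly t) (F n)|%:R / (p ^ n)%:R : R)
        @[n --> within (exponents q p delta nu) \oo] -->
      (((Qprod q p nu I)%:R + (Qprod q p nu J)%:R)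
         / (2 * (Qprod q p nu I)%:R * (Qprod q p nu J)%:R) : R).
Proof.
have qp i : coprime (q i) p.
  by rewrite prime_coprime// dvdn_prime2//; apply/eqP => e; exact: (p_neq_q i).
have p1 := prime_gt1 p_prime.
have t0 : (0 < t)%N.
  by rewrite t_def prodn_gt0// => i; rewrite expn_gt0 prime_gt0.
pose I := [set i | mult_ord (q i) p %| delta]%N%SET.
pose J := [set i | ~~ (mult_ord (q i) p %| delta)
                   && (mult_ord (q i) p %| delta * 2)]%N%SET.
exists I, J; split.
  rewrite -setI_eq0; apply/eqP/setP => i; rewrite !inE.
  by case: (_ %| _)%N.
move=> F cardF.
have partI n : exponents q p delta nu n ->
    ((p ^ n - 1)`_\pi(t))%N = Qprod q p nu I.
  move=> nE; have [n0 _ nuE] := nE.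
  rewrite t_def partn_pi_prod_primes// ?subn_gt0; last first.
    by rewrite -[1%N](exp1n n) ltn_exp2r.
  rewrite /Qprod [RHS]big_mkcond /=; apply: eq_bigr => i _.
  rewrite logn_subn1_expn// inE (exponents_dvdn i nE).1 nuE.
  by case: ifP.
have partJ n : exponents q p delta nu n ->
    ((p ^ n + 1)`_\pi(t))%N = Qprod q p nu J.
  move=> nE; have [n0 _ nuE] := nE.
  rewrite t_def partn_pi_prod_primes//; last by rewrite addn1.
  rewrite /Qprod [RHS]big_mkcond /=; apply: eq_bigr => i _.
  rewrite logn_addn1_expn// inE (exponents_dvdn i nE).1 (exponents_dvdn i nE).2 nuE.
  by case: ifP.
have Q0 (X : {set 'I_r}) : (Qprod q p nu X)%:R != 0 :> R.
  by rewrite pnatr_eq0 -lt0n prodn_gt0// => i; rewrite expn_gt0 prime_gt0.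
set QI := (Qprod q p nu I)%:R; set QJ := (Qprod q p nu J)%:R.
have P0 n : (p ^ n)%:R != 0 :> R by rewrite pnatr_eq0 -lt0n expn_gt0 prime_gt0.
(* With [N = p ^ n], this is [(A + B) / (2 N)] for [A = (N - 1) / QI] and [B = (N + 1) / QJ], split
   into the limit and a multiple of [1 / N]. *)
pose g (n : nat) : R :=
  (QI + QJ) / (2 * QI * QJ) + (QJ^-1 - QI^-1) / 2 * (p%:R^-1) ^+ n.
have ratioE : {in exponents q p delta nu,
    (fun n => #|Per (chebyshev_poly t) (F n)|%:R / (p ^ n)%:R) =1 g}.
  move=> n /set_mem nE; have [n0 _ _] := nE.
  have := card_Per_chebyshev (F n) t0.
  rewrite cardF// -subn1 -addn1.
  have := partnC \pi(t) (n := (p ^ n + 1)%N); rewrite partJ// addn1 => /(_ isT).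
  have := partnC \pi(t) (n := (p ^ n - 1)%N); rewrite partI// subn_gt0.
  have pn1 : (1 < p ^ n)%N by rewrite -[1%N](exp1n n) ltn_exp2r.
  move=> /(_ pn1).
  move: (_`__)%N (_`__)%N => B A.
  move=> /(congr1 (fun k => k%:R : R)); rewrite natrB ?(ltnW pn1)// natrM => EA.
  move=> /(congr1 (fun k => k%:R : R)); rewrite -natr1 natrM => EB.
  move=> /(congr1 (fun k => k%:R : R)); rewrite natrD natrM => EC.
  have -> : #|Per (chebyshev_poly t) (F n)|%:R = (A%:R + B%:R) / 2 :> R.
    by rewrite -EC mulfK// pnatr_eq0.
  have -> : A%:R = ((p ^ n)%:R - 1) / QI :> R.
    by rewrite -EA mulrAC mulfV// mul1r.
  have -> : B%:R = ((p ^ n)%:R + 1) / QJ :> R.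
    by rewrite -EB mulrAC mulfV// mul1r.
  rewrite /g exprVn -natrX; field; rewrite !Q0 P0 //.
(* [g] makes sense for every [n], so it is enough that it converges along all of [\oo]. *)
apply: (cvg_trans (fmap_within_eq _ ratioE)); apply: cvg_within_filter.
suff : g n @[n --> \oo] -->
    (QI + QJ) / (2 * QI * QJ) + (QJ^-1 - QI^-1) / 2 * 0 by rewrite mulr0 addr0.
apply: cvgD; first exact: cvg_cst.
apply: cvgM; first exact: cvg_cst.
apply: cvg_expr; rewrite ger0_norm ?invr_ge0// invf_lt1 ?ltr0n ?prime_gt0//.
by rewrite ltr1n.
Qed.
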